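(* Let $E$ be a Lie algebroid over $M$, let $\mathcal F\subseteq\Gamma(E)$ be a singular subalgebroid, and let $(A,[\cdot,\cdot]_A,\rho)$ and $(A',[\cdot,\cdot]_{A'},\rho')$ be two $E$-valued almost Lie algebroids over $\mathcal F$, where the rank of the anchors on $M_{\mathrm{reg}}$ is a constant $r$. Then the Nash blow-up of $M$ along $\mathcal F$ does not depend on this choice: the set $\mathrm{Nbl}_{\mathcal F}(M)\subseteq\mathrm{Grass}_{-r}(A)$ constructed from $A$ and the set $\mathrm{Nbl}_{\mathcal F}(M)\subseteq\mathrm{Grass}_{-r}(A')$ constructed from $A'$ are canonically isomorphic, by an isomorphism commuting with their projections to $M$.
   Context: $\mathbb K\in\{\mathbb R,\mathbb C\}$; $M$ is a smooth, real analytic or complex manifold, or an algebraic variety over $\mathbb K$; $\mathcal O_M$ is its algebra (sheaf) of functions. $(E,[\cdot,\cdot]_E,\rho_E)$ denotes the Lie algebroid. A singular subalgebroid of $E$ is a locally finitely generated $\mathcal O_M$-submodule $\mathcal F\subseteq\Gamma(E)$ with $[\mathcal F,\mathcal F]_E\subseteq\mathcal F$. An $E$-valued almost Lie algebroid over $\mathcal F$ is a vector bundle $A\to M$ with a vector bundle morphism $\rho\colon A\to E$ over $\mathrm{id}_M$ with $\rho(\Gamma(A))=\mathcal F$ and a skew-symmetric bilinear bracket $[\cdot,\cdot]_A$ on $\Gamma(A)$ such that $\rho([a,b]_A)=[\rho(a),\rho(b)]_E$ and $[a,fb]_A=(\rho_E\circ\rho)(a)[f]\,b+f[a,b]_A$.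 $M_{\mathrm{reg}}\subseteq M$ is the open dense subset where $x\mapsto\dim\mathrm{Im}\,\rho_x$ is locally constant (it depends only on $\mathcal F$); $r$ is the rank of $\rho$ on $M_{\mathrm{reg}}$, assumed constant. $P\colon\mathrm{Grass}_{-r}(A)\to M$ is the bundle whose fiber at $x$ is the Grassmannian of subspaces of $A_x$ of codimension $r$. The Nash blow-up constructed from $A$ is the closure in $\mathrm{Grass}_{-r}(A)$ of $\{\ker\rho_x : x\in M_{\mathrm{reg}}\}$, with projection to $M$ the restriction of $P$; similarly for $A'$. ''Canonically isomorphic'' means there is a bijection over $M$ that does not depend on any auxiliary choices. *)

(* Defs.v *)
From HB Require Import structures.
From mathcomp Require Import all_boot all_order all_algebra.
From mathcomp Require Import all_classical all_reals all_analysis.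
From mathcomp Require Import complex.

Set Implicit Arguments.
Unset Strict Implicit.
Unset Printing Implicit Defensive.

Import Order.TTheory GRing.Theory Num.Theory.
Import numFieldNormedType.Exports.

Local Open Scope classical_set_scope.
Local Open Scope ring_scope.

Definition eq_on (T : Type) (B : T -> Type) (U : set T) (s t : forall x, B x) :=
  forall x, U x -> s x = t x.

(* The K-subalgebra of K-valued functions on T generated by G. *)
Inductive subalg (K : numFieldType) (T : Type) (G : set (T -> K)) :
    (T -> K) -> Prop :=
| subalg_gen f : G f -> subalg G f
| subalg_cst c : subalg G (fun=> c)
| subalg_add f h : subalg G f -> subalg G h -> subalg G (fun x => f x + h x)
| subalg_mul f h : subalg G f -> subalg G h -> subalg G (fun x => f x * h x).

(* A topological space with a sheaf of K-valued functions. Functions on an open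
   set U are represented by total functions, of which only the restriction to U
   matters: [regular U f] means that the restriction of f to U belongs to O(U).
   All properties of [regular U] are required for open U only. *)
Record kspace (K : numFieldType) := KSpace {
  carrier :> topologicalType;
  regular : set carrier -> (carrier -> K) -> Prop;
  regular_ext : forall U f h, open U -> eq_on U f h -> regular U f -> regular U h;
  regular_sub : forall U V f, open U -> open V -> V `<=` U ->
    regular U f -> regular V f;
  regular_glue : forall U f, open U ->
    (forall x, U x -> exists V, [/\ open V, V x, V `<=` U & regular V f]) ->
    regular U f;
  regular_cst : forall U (c : K), open U -> regular U (fun=> c);
  regular_add : forall U f h, open U -> regular U f -> regular U h ->
    regular U (fun x => f x + h x);
  regular_mul : forall U f h, open U -> regular U f -> regular U h ->
    regular U (fun x => f x * h x) }.

Section Models.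
Variable K : numFieldType.

Fixpoint Ck n (k : nat) (U : set 'rV[K]_n) (f : 'rV[K]_n -> K) : Prop :=
  (forall x, U x -> {for x, continuous f}) /\
  if k is k'.+1 then
    forall j : 'I_n, (forall x, U x -> derivable f x (delta_mx 0 j)) /\
      Ck k' U (fun x => 'D_(delta_mx 0 j) f x)
  else True.

Definition smooth_fun n (U : set 'rV[K]_n) (f : 'rV[K]_n -> K) : Prop :=
  forall k, Ck k U f.

(* The (absolutely convergent) multiple power series with coefficients c,
   centred at a, has sum l at x; partial sums run over the multi-indices with
   all entries < N. *)
Definition power_series_sum n (c : ('I_n -> nat) -> K) (a x : 'rV[K]_n) (l : K) :=
  let term (al : 'I_n -> nat) := c al * \prod_i (x 0 i - a 0 i) ^+ al i in
  (exists B : K, forall N : nat,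
     \sum_(al : {ffun 'I_n -> 'I_N}) `|term (fun i => al i : nat)| <= B) /\
  ((fun N : nat => \sum_(al : {ffun 'I_n -> 'I_N}) term (fun i => al i : nat))
     @ \oo --> l).

Definition analytic_fun n (U : set 'rV[K]_n) (f : 'rV[K]_n -> K) : Prop :=
  smooth_fun U f /\
  forall a, U a -> exists c, \forall x \near a, power_series_sum c a x (f x).

Definition holomorphic_fun n (U : set 'rV[K]_n) (f : 'rV[K]_n -> K) : Prop :=
  forall x, U x -> differentiable f x.

Definition polynomial_fun n : ('rV[K]_n -> K) -> Prop :=
  subalg [set p | exists i, p = (fun x : 'rV[K]_n => x 0 i)].

Definition algebraic_set n (X : set 'rV[K]_n) : Prop :=
  exists S : set ('rV[K]_n -> K), S `<=` polynomial_fun (n := n) /\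
    X = [set x | forall p, S p -> p x = 0].

Definition zariski_open_in n (X W : set 'rV[K]_n) : Prop :=
  exists Z, algebraic_set Z /\ W = X `\` Z.

Definition rational_fun n (W : set 'rV[K]_n) (f : 'rV[K]_n -> K) : Prop :=
  forall a, W a -> exists p q, [/\ polynomial_fun p, polynomial_fun q, q a != 0 &
    forall b, W b -> q b != 0 -> f b = p b / q b].

(* h identifies the open subset U of M with the subset h @` U of K^n, whose open
   subsets are given by mopen and whose functions are given by mfun. *)
Definition is_chart (M : kspace K) n (mopen : set 'rV[K]_n -> Prop)
    (mfun : set 'rV[K]_n -> ('rV[K]_n -> K) -> Prop)
    (U : set M) (h : M -> 'rV[K]_n) : Prop :=
  [/\ open U,
      {in U &, injective h},
      forall V, V `<=` U -> (open V <-> mopen (h @` V)) &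
      forall V f, open V -> V `<=` U ->
        (regular V f <->
         exists2 w, mfun (h @` V) w & forall x, V x -> f x = w (h x))].

Definition is_manifold
    (mfun : forall n, set 'rV[K]_n -> ('rV[K]_n -> K) -> Prop) (M : kspace K) :=
  [/\ hausdorff_space M,
      @second_countable M &
      forall x : M, exists n U (h : M -> 'rV[K]_n),
        U x /\ is_chart (fun W => open W) (mfun n) U h].

Definition is_affine_open (M : kspace K) (U : set M) : Prop :=
  exists n (h : M -> 'rV[K]_n), algebraic_set (h @` U) /\
    is_chart (zariski_open_in (h @` U)) (@rational_fun n) U h.

(* The complement of the diagonal is open in the Zariski topology of the product
   variety M x M. *)
Definition separated (M : kspace K) : Prop :=
  forall x y : M, x <> y -> exists U V p,
    [/\ open U /\ U x, open V /\ V y,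
        subalg [set q : M * M -> K |
          (exists2 f, regular U f & q = (fun z => f z.1)) \/
          (exists2 f, regular V f & q = (fun z => f z.2))] p,
        p (x, y) != 0 &
        forall z, U z -> V z -> p (z, z) = 0].

Definition is_algebraic_variety (M : kspace K) : Prop :=
  separated M /\
  exists N (U : 'I_N -> set M),
    (forall i, is_affine_open (U i)) /\ (forall x, exists i, U i x).

End Models.

Inductive geometry (R : realType) : numFieldType -> Type :=
| Smooth : geometry R R
| RealAnalytic : geometry R R
| Holomorphic : geometry R R[i]
| RealAlgebraic : geometry R R
| ComplexAlgebraic : geometry R R[i].

Definition is_geometric (R : realType) (K : numFieldType) (g : geometry R K)
    (M : kspace K) : Prop :=
  match g in geometry _ K0 return kspace K0 -> Prop with
  | Smooth => is_manifold (@smooth_fun R)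
  | RealAnalytic => is_manifold (@analytic_fun R)
  | Holomorphic => is_manifold (@holomorphic_fun R[i])
  | RealAlgebraic => @is_algebraic_variety R
  | ComplexAlgebraic => @is_algebraic_variety R[i]
  end M.

Definition is_algebraic (R : realType) (K : numFieldType) (g : geometry R K) :=
  match g with RealAlgebraic | ComplexAlgebraic => true | _ => false end.

Section Bundles.
Variables (K : numFieldType) (M : kspace K).

(* As for functions, sections over U are represented by total families, and
   [sect U s] means that the restriction of s to U belongs to Gamma(U, B). *)
Definition frame_on (fib : M -> vectType K)
    (sect : set M -> (forall x, fib x) -> Prop)
    (U : set M) n (e : 'I_n -> forall x, fib x) : Prop :=
  [/\ open U,
      forall y, U y -> basis_of {: fib y} [seq e i y | i <- enum 'I_n] &
      forall V s, open V -> V `<=` U ->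
        (sect V s <-> exists f : 'I_n -> M -> K,
           (forall i, regular V (f i)) /\
           forall y, V y -> s y = \sum_i f i y *: e i y)].

Record vbundle := VBundle {
  fib :> M -> vectType K;
  sect : set M -> (forall x, fib x) -> Prop;
  sect_sub : forall U V s, open U -> open V -> V `<=` U -> sect U s -> sect V s;
  sect_glue : forall U s, open U ->
    (forall x, U x -> exists V, [/\ open V, V x, V `<=` U & sect V s]) ->
    sect U s;
  sect_trivial : forall x, exists U n (e : 'I_n -> forall x, fib x),
    U x /\ frame_on sect U e }.

Definition is_frame (B : vbundle) U n (e : 'I_n -> forall x, B x) : Prop :=
  frame_on (@sect B) U e.

Definition bundle_map_on (B B' : vbundle) (U : set M)
    (phi : forall x, 'Hom(B x, B' x)) : Prop :=
  forall V s, open V -> V `<=` U -> sect V s -> sect V (fun x => phi x (s x)).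

(* A bundle map from B to the tangent bundle over the identity; a vector v of
   B x acts on germs of functions at x as a point derivation, and sections act
   on O_M as derivations. *)
Record is_anchor (B : vbundle) (rho : forall x, B x -> (M -> K) -> K) : Prop := {
  anchor_germ : forall U x v f h, open U -> U x -> regular U f -> eq_on U f h ->
    rho x v f = rho x v h;
  anchor_linear : forall U x c v w f, open U -> U x -> regular U f ->
    rho x (c *: v + w) f = c * rho x v f + rho x w f;
  anchor_cst : forall x v c, rho x v (fun=> c) = 0;
  anchor_add : forall U x v f h, open U -> U x -> regular U f -> regular U h ->
    rho x v (fun y => f y + h y) = rho x v f + rho x v h;
  anchor_mul : forall U x v f h, open U -> U x -> regular U f -> regular U h ->
    rho x v (fun y => f y * h y) = f x * rho x v h + rho x v f * h x;
  anchor_regular : forall U s f, open U -> sect U s -> regular U f ->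
    regular U (fun x => rho x (s x) f) }.

(* A skew-symmetric K-bilinear bracket on the sheaf of sections: [br s t] is
   meaningful on any open set over which s and t are sections. *)
Record is_bracket (B : vbundle)
    (br : (forall x, B x) -> (forall x, B x) -> forall x, B x) : Prop := {
  bracket_sect : forall U s t, open U -> sect U s -> sect U t -> sect U (br s t);
  bracket_germ : forall U s s' t t', open U -> sect U s -> sect U t ->
    eq_on U s s' -> eq_on U t t' -> eq_on U (br s t) (br s' t');
  bracket_skew : forall U s t, open U -> sect U s -> sect U t ->
    eq_on U (br s t) (fun x => - br t s x);
  bracket_linear : forall U c s s' t, open U -> sect U s -> sect U s' -> sect U t ->
    eq_on U (br (fun x => c *: s x + s' x) t)
            (fun x => c *: br s t x + br s' t x) }.

Record lie_algebroid := LieAlgebroid {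
  la_bundle :> vbundle;
  la_anchor : forall x, la_bundle x -> (M -> K) -> K;
  la_bracket : (forall x, la_bundle x) -> (forall x, la_bundle x) ->
    forall x, la_bundle x;
  la_anchorP : is_anchor la_anchor;
  la_bracketP : is_bracket la_bracket;
  la_jacobi : forall U s t u, open U -> sect U s -> sect U t -> sect U u ->
    eq_on U (fun x => la_bracket s (la_bracket t u) x
                    + la_bracket t (la_bracket u s) x
                    + la_bracket u (la_bracket s t) x) (fun=> 0);
  la_leibniz : forall U s t f, open U -> sect U s -> sect U t -> regular U f ->
    eq_on U (la_bracket s (fun x => f x *: t x))
            (fun x => la_anchor (s x) f *: t x + f x *: la_bracket s t x);
  la_anchor_bracket : forall U s t f, open U ->
    sect U s -> sect U t -> regular U f ->
    eq_on U (fun x => la_anchor (la_bracket s t x) f)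
            (fun x => la_anchor (s x) (fun y => la_anchor (t y) f)
                    - la_anchor (t x) (fun y => la_anchor (s y) f)) }.

(* A locally finitely generated subsheaf of O_M-modules of Gamma(E) which is
   closed under the bracket. *)
Record singular_subalgebroid (E : lie_algebroid) := SingularSubalgebroid {
  sub_sect :> set M -> (forall x, E x) -> Prop;
  sub_sectW : forall U s, open U -> sub_sect U s -> sect U s;
  sub_ext : forall U s t, open U -> eq_on U s t -> sub_sect U s -> sub_sect U t;
  sub_sub : forall U V s, open U -> open V -> V `<=` U ->
    sub_sect U s -> sub_sect V s;
  sub_glue : forall U s, open U ->
    (forall x, U x -> exists V, [/\ open V, V x, V `<=` U & sub_sect V s]) ->
    sub_sect U s;
  sub_zero : forall U, open U -> sub_sect U (fun=> 0);
  sub_add : forall U s t, open U -> sub_sect U s -> sub_sect U t ->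
    sub_sect U (fun x => s x + t x);
  sub_scale : forall U f s, open U -> regular U f -> sub_sect U s ->
    sub_sect U (fun x => f x *: s x);
  sub_fingen : forall x, exists U k (u : 'I_k -> forall x, E x),
    [/\ open U, U x, forall i, sub_sect U (u i) &
        forall V s, open V -> V `<=` U -> sub_sect V s ->
          forall y, V y -> exists W (f : 'I_k -> M -> K),
            [/\ open W, W y, W `<=` V, forall i, regular W (f i) &
                eq_on W s (fun z => \sum_i f i z *: u i z)]];
  sub_bracket : forall U s t, open U -> sub_sect U s -> sub_sect U t ->
    sub_sect U (la_bracket s t) }.

(* An E-valued almost Lie algebroid over F. The field [al_image] is the equality
   rho(Gamma(A)) = F of sheaves. *)
Record almost_lie_algebroid (E : lie_algebroid) (F : singular_subalgebroid E) :=
  AlmostLieAlgebroid {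
  al_bundle :> vbundle;
  al_rho : forall x, 'Hom(al_bundle x, E x);
  al_bracket : (forall x, al_bundle x) -> (forall x, al_bundle x) ->
    forall x, al_bundle x;
  al_rhoP : bundle_map_on setT al_rho;
  al_image : forall U s, open U -> (F U s <->
    forall x, U x -> exists V (a : forall x, al_bundle x),
      [/\ open V, V x, V `<=` U, sect V a & eq_on V s (fun y => al_rho y (a y))]);
  al_bracketP : is_bracket al_bracket;
  al_rho_bracket : forall U a b, open U -> sect U a -> sect U b ->
    eq_on U (fun x => al_rho x (al_bracket a b x))
            (la_bracket (fun x => al_rho x (a x)) (fun x => al_rho x (b x)));
  al_leibniz : forall U a b f, open U -> sect U a -> sect U b -> regular U f ->
    eq_on U (al_bracket a (fun x => f x *: b x))
            (fun x => la_anchor (al_rho x (a x)) f *: b x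
                    + f x *: al_bracket a b x) }.

Definition rho_rank (E : lie_algebroid) (F : singular_subalgebroid E)
    (A : almost_lie_algebroid F) (x : M) : nat := \dim (limg (al_rho A x)).

Definition Mreg (E : lie_algebroid) (F : singular_subalgebroid E)
    (A : almost_lie_algebroid F) : set M :=
  [set x | \forall y \near x, rho_rank A y = rho_rank A x].

End Bundles.

Arguments al_rho {K M E F} _ _.

Record grass (K : numFieldType) (M : kspace K) (A : vbundle M) (r : nat) := Grass {
  gpt : M;
  gsub : {vspace A gpt};
  gcodim : (\dim gsub + r = \dim {: A gpt})%N }.

(* The total space of Grass_{-r}(A); its topology, defined below, depends on the
   kind of geometry. *)
Definition grass_space (R : realType) (K : numFieldType) (g : geometry R K)
  (M : kspace K) (A : vbundle M) (r : nat) : Type := grass A r.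

Section Grassmann.
Variables (R : realType) (K : numFieldType) (g : geometry R K) (M : kspace K).

(* Polynomials in the entries of a matrix with coefficients in O(U). *)
Definition poly_over n r (U : set M) : (M * 'M[K]_(n, r) -> K) -> Prop :=
  subalg [set q | (exists2 f, regular U f &
                     q = (fun z : M * 'M[K]_(n, r) => f z.1)) \/
                  (exists i j, q = (fun z : M * 'M[K]_(n, r) => z.2 i j))].

(* The open subsets of M x K^(n * r): for the product topology in the manifold
   cases, and for the Zariski topology of the product variety (generated by the
   loci p <> 0, p in O(U)[t_ij]) in the algebraic
   cases. *)
Definition open_in_prod n r (W : set (M * 'M[K]_(n, r))) : Prop :=
  if is_algebraic g then
    forall w, W w -> exists U (p : M * 'M[K]_(n, r) -> K),
      [/\ open U, U w.1,
          poly_over U p,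
          p w != 0 &
          forall z, U z.1 -> p z != 0 -> W z]
  else open W.

Lemma open_in_prodT n r : open_in_prod [set: M * 'M[K]_(n, r)].
Proof.
rewrite /open_in_prod; case: ifP => _; last exact: openT.
move=> w _; exists setT, (fun=> 1); split.
- exact: openT.
- by [].
- exact: subalg_cst.
- exact: oner_neq0.
- by [].
Qed.

Lemma open_in_prodI n r (W1 W2 : set (M * 'M[K]_(n, r))) :
  open_in_prod W1 -> open_in_prod W2 -> open_in_prod (W1 `&` W2).
Proof.
rewrite /open_in_prod; case: ifP => _; last exact: openI.
have mono (U V : set M) (p : M * 'M[K]_(n, r) -> K) :
    open U -> open V -> V `<=` U ->
    poly_over U p -> poly_over V p.
  move=> oU oV VU; elim=> [q [[f rf ->]|hq]|c|f h _ + _ +|f h _ + _ +].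
  - by apply: subalg_gen; left; exists f => //; exact: regular_sub rf.
  - by apply: subalg_gen; right.
  - exact: subalg_cst.
  - exact: subalg_add.
  - exact: subalg_mul.
move=> h1 h2 w [/h1[U [p [oU Uw sp pw hp]]] /h2[V [q [oV Vw sq qw hq]]]].
exists (U `&` V), (fun z => p z * q z).
have oI : open (U `&` V) by exact: openI.
split=> //.
- apply: subalg_mul.
  + by apply: mono sp => // z [].
  + by apply: mono sq => // z [].
- by rewrite mulf_neq0.
- move=> z [Uz Vz]; rewrite mulf_eq0 negb_or => /andP[pz qz].
  by split; [exact: hp|exact: hq].
Qed.

Lemma open_in_prod_bigU n r (I : Type) (W : I -> set (M * 'M[K]_(n, r))) :
  (forall i, open_in_prod (W i)) -> open_in_prod (\bigcup_i W i).
Proof.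
rewrite /open_in_prod; case: ifP => _ hW; last first.
  by apply: bigcup_open => i _; exact: hW.
move=> w [i _ /hW[U [p [oU Uw sp pw hp]]]].
by exists U, p; split=> // z Uz pz; exists i => //; exact: hp.
Qed.

Variables (A : vbundle M) (r : nat).
Local Notation grass := (grass_space g A r).

HB.instance Definition _ := gen_eqMixin grass.
HB.instance Definition _ := gen_choiceMixin grass.

(* In the coordinates given by a basis e of a vector space, V is the (left)
   kernel of the matrix T. *)
Definition kernel_coords (L : vectType K) n (e : 'I_n -> L) (T : 'M[K]_(n, r))
    (V : {vspace L}) : Prop :=
  forall c : 'rV[K]_n, (\sum_i c 0 i *: e i \in V) = (c *m T == 0).

(* The topology of the Grassmann bundle: over an open set with a frame, it is
   the quotient topology for (y, T) |-> (y, ker T), where T ranges over the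
   n x r matrices of rank r. *)
Definition grass_open (O : set grass) : Prop :=
  forall U n (e : 'I_n -> forall x, A x), is_frame U e ->
    exists2 W : set (M * 'M[K]_(n, r)), open_in_prod W &
      forall p T, U (gpt p) -> kernel_coords (e ^~ (gpt p)) T (gsub p) ->
        (O p <-> W (gpt p, T)).

Lemma grass_openT : grass_open setT.
Proof. by move=> U n e _; exists setT => //; exact: open_in_prodT. Qed.

Lemma grass_openI O1 O2 :
  grass_open O1 -> grass_open O2 -> grass_open (O1 `&` O2).
Proof.
move=> h1 h2 U n e Ue.
have [W1 o1 e1] := h1 _ _ _ Ue; have [W2 o2 e2] := h2 _ _ _ Ue.
exists (W1 `&` W2); first exact: open_in_prodI.
move=> p T Up pT; have := e1 _ _ Up pT; have := e2 _ _ Up pT.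
by rewrite /setI /=; tauto.
Qed.

Lemma grass_open_bigU (I : Type) (O : I -> set grass) :
  (forall i, grass_open (O i)) -> grass_open (\bigcup_i O i).
Proof.
move=> hO U n e Ue.
have /choice[W hW] i : exists W : set (M * 'M[K]_(n, r)), open_in_prod W /\
    forall p T, U (gpt p) -> kernel_coords (e ^~ (gpt p)) T (gsub p) ->
      (O i p <-> W (gpt p, T)).
  by have [W] := hO i _ _ _ Ue; exists W.
exists (\bigcup_i W i); first by apply: open_in_prod_bigU => i; have [] := hW i.
move=> p T Up pT; split=> -[i _ h]; exists i => //.
- by apply/(proj2 (hW i) _ _ Up pT).
- by apply/(proj2 (hW i) _ _ Up pT).
Qed.

HB.instance Definition _ := isOpenTopological.Build grass
  grass_openT grass_openI grass_open_bigU.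

End Grassmann.

Section Nash.
Variables (R : realType) (K : numFieldType) (g : geometry R K) (M : kspace K).
Variables (E : lie_algebroid M) (F : singular_subalgebroid E) (r : nat).

Definition nash_blowup (A : almost_lie_algebroid F) : set (grass_space g A r) :=
  closure [set p : grass_space g A r |
    Mreg A (gpt p) /\ gsub p = lker (al_rho A (gpt p))].
Arguments nash_blowup : clear implicits.

(* The choices that enter the identification of two Nash blow-ups: an open set U
   and a vector bundle morphism phi : A|U -> A'|U with rho' \o phi = rho. *)
Definition is_comparison (A A' : almost_lie_algebroid F) (U : set M)
    (phi : forall x, 'Hom(A x, A' x)) : Prop :=
  [/\ open U, bundle_map_on U phi &
      forall x, U x -> (al_rho A' x \o phi x)%VF = al_rho A x].

(* (x, V) and (x, V') correspond to each other when V is the preimage of V'. *)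
Inductive corresponds (A A' : vbundle M) (phi : forall x, 'Hom(A x, A' x)) :
    grass A r -> grass A' r -> Prop :=
| Corresponds x (V : {vspace A x}) (V' : {vspace A' x}) hV hV' :
    V = (phi x @^-1: V')%VS ->
    corresponds phi (@Grass _ _ A r x V hV) (@Grass _ _ A' r x V' hV').

(* [Phi] extends the tautological identification ker rho_x <-> ker rho'_x over
   Mreg, and over any open set U it is induced by every comparison morphism. *)
Definition is_canonical (A A' : almost_lie_algebroid F)
    (Phi : nash_blowup A -> nash_blowup A') : Prop :=
  (forall p, Mreg A (gpt (val p)) ->
     gsub (val p) = lker (al_rho A (gpt (val p))) ->
     gsub (val (Phi p)) = lker (al_rho A' (gpt (val (Phi p))))) /\
  (forall U phi, is_comparison U phi -> forall p, U (gpt (val p)) ->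
     corresponds phi (val p) (val (Phi p))).

End Nash.

Arguments nash_blowup {R K} g {M E F} r A.

(* Main.v *)
(* Lifting a local frame of A through rho' gives, near every point, bundle
   morphisms phi : A -> A' and psi : A' -> A commuting with the anchors. The
   difference of id and psi o phi takes its values in ker rho over Mreg, and
   lying in the tautological subspace is a closed condition, so for every point
   (x, V) of the Nash blow-up psi_x o phi_x is the identity modulo V. Hence
   psi_x^-1 V has codimension r and is the unique V' in the other blow-up with
   phi_x^-1 V' = V, whatever phi is. That (x, psi_x^-1 V) again lies in the closure
   follows from the continuity of V |-> psi^-1 V on the open locus where the
   preimage has codimension r; there, in frames, a matrix T with kernel V goes to
   P T, where P is the matrix of psi. *)
Require Import Defs.
From mathcomp Require Import all_boot all_order perm all_algebra.
From mathcomp Require Import all_classical all_reals all_analysis.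

Set Implicit Arguments.
Unset Strict Implicit.
Unset Printing Implicit Defensive.

Import GRing.Theory.
Import numFieldNormedType.Exports.

Local Open Scope classical_set_scope.
Local Open Scope ring_scope.

(** * Continuity of regular functions in the manifold cases *)

Section RegularFunctions.
Variables (K : numFieldType) (M : kspace K).

Lemma regular_sum (U : set M) (I : Type) (s : seq I) (f : I -> M -> K) :
  open U -> (forall i, regular U (f i)) ->
  regular U (fun x => \sum_(i <- s) f i x).
Proof.
move=> oU rf; elim: s => [|i s IHs].
  rewrite (_ : (fun _ => _) = fun=> 0); first exact: regular_cst.
  by apply/funext => x; rewrite big_nil.
rewrite (_ : (fun _ => _) = fun x => f i x + \sum_(j <- s) f j x).
  exact: regular_add.
by apply/funext => x; rewrite big_cons.
Qed.

(** A notion for the manifold cases: on a variety with its Zariski topology, a regular function into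
    the metric field [K] is in general not continuous. *)
Definition regular_continuous : Prop := forall (U : set M) f,
  open U -> regular U f -> forall x, U x -> {for x, continuous f}.

(* Charts are only required to identify open sets and functions, so continuity is
   read off the image in the chart. *)
Lemma manifold_regular_continuous
    (mfun : forall n, set 'rV[K]_n -> ('rV[K]_n -> K) -> Prop) :
  (forall n U w, mfun n U w -> forall x, U x -> {for x, continuous w}) ->
  is_manifold mfun M -> regular_continuous.
Proof.
move=> cont_mfun [_ _ charts] U f oU rf x Ux.
have [n [U0 [h [U0x [oU0 hI hopen hfun]]]]] := charts x.
pose V := U `&` U0.
have oV : open V by exact: openI.
have VU0 : V `<=` U0 by apply: subIsetr.
have rfV : regular V f by apply: regular_sub rf => //; apply: subIsetl.
have [w mw fE] := (hfun V f oV VU0).1 rfV.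
have ohV : open (h @` V) by apply/hopen.
move=> B nB.
(* Asking that [B] be a neighbourhood of the value, not just contain it, makes [V2] the preimage of
   the interior of [B]; its openness is then checked in the chart. *)
pose V2 := [set y | V y /\ nbhs (w (h y)) B].
have oV2 : open V2.
  have /hopen -> : V2 `<=` U0 by move=> y [/VU0].
  have -> : h @` V2 = h @` V `&` [set z | nbhs (w z) B].
    apply/seteqP; split=> [_ [y [Vy By] <-]|_ [[y Vy <-] By]].
      by split=> //; exists y.
    by exists y.
  rewrite openE => z [Vz /nbhs_interior Bz]; apply: filterI.
    exact: open_nbhs_nbhs.
  exact: cont_mfun mw z Vz _ Bz.
have V2x : V2 x by split=> //; rewrite -fE.
apply: filterS (open_nbhs_nbhs (conj oV2 V2x)) => y [Vy /nbhs_singleton].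
by rewrite /preimage /= fE.
Qed.

End RegularFunctions.

Lemma geometric_regular_continuous (R : realType) (K : numFieldType)
    (g : geometry R K) (M : kspace K) :
  is_geometric g M -> ~~ is_algebraic g -> regular_continuous M.
Proof.
case: g M => //= M gM _; apply: manifold_regular_continuous gM => n U w.
- by move=> /(_ 0%N) [].
- by move=> [/(_ 0%N) []].
- by move=> dw x Ux; apply/differentiable_continuous/dw.
Qed.

(** * Open loci defined by polynomials in the product of [M] with a matrix space *)

Section PolynomialLoci.
Variables (R : realType) (K : numFieldType) (g : geometry R K) (M : kspace K).
Hypothesis gM : is_geometric g M.

Lemma poly_over_subset n r (U V : set M) (p : M * 'M[K]_(n, r) -> K) :
  open U -> open V -> V `<=` U -> poly_over U p -> poly_over V p.
Proof.
move=> oU oV VU; elim=> [q [[f rf ->]|hq]|c|f h _ + _ +|f h _ + _ +].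
- by apply: subalg_gen; left; exists f => //; exact: regular_sub rf.
- by apply: subalg_gen; right.
- exact: subalg_cst.
- exact: subalg_add.
- exact: subalg_mul.
Qed.

Lemma poly_over_regular n r (U : set M) f :
  regular U f -> poly_over U (fun z : M * 'M[K]_(n, r) => f z.1).
Proof. by move=> rf; apply: subalg_gen; left; exists f. Qed.

Lemma poly_over_coord n r (U : set M) i j :
  poly_over U (fun z : M * 'M[K]_(n, r) => z.2 i j).
Proof. by apply: subalg_gen; right; exists i, j. Qed.

Lemma poly_over_sum n r (U : set M) (I : Type) (s : seq I)
    (p : I -> M * 'M[K]_(n, r) -> K) :
  (forall i, poly_over U (p i)) ->
  poly_over U (fun z => \sum_(i <- s) p i z).
Proof.
move=> hp; elim: s => [|i s IHs].
  rewrite (_ : (fun _ => _) = fun=> 0); first exact: subalg_cst.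
  by apply/funext => z; rewrite big_nil.
rewrite (_ : (fun _ => _) = fun z => p i z + \sum_(j <- s) p j z).
  exact: subalg_add (hp i) IHs.
by apply/funext => z; rewrite big_cons.
Qed.

Lemma poly_over_prod n r (U : set M) (I : Type) (s : seq I)
    (p : I -> M * 'M[K]_(n, r) -> K) :
  (forall i, poly_over U (p i)) ->
  poly_over U (fun z => \prod_(i <- s) p i z).
Proof.
move=> hp; elim: s => [|i s IHs].
  rewrite (_ : (fun _ => _) = fun=> 1); first exact: subalg_cst.
  by apply/funext => z; rewrite big_nil.
rewrite (_ : (fun _ => _) = fun z => p i z * \prod_(j <- s) p j z).
  exact: subalg_mul (hp i) IHs.
by apply/funext => z; rewrite big_cons.
Qed.

Lemma poly_over_comp n r n' r' (U : set M)
    (q : 'I_n' -> 'I_r' -> M * 'M[K]_(n, r) -> K)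
    (p : M * 'M[K]_(n', r') -> K) :
  (forall j k, poly_over U (q j k)) -> poly_over U p ->
  poly_over U (fun z => p (z.1, \matrix_(j, k) q j k z)).
Proof.
move=> hq; elim=> [_ [[f rf ->]|[j [k ->]]]|c|f h _ + _ +|f h _ + _ +].
- exact: poly_over_regular.
- rewrite (_ : (fun _ => _) = q j k) //.
  by apply/funext => z; rewrite mxE.
- exact: subalg_cst.
- exact: subalg_add.
- exact: subalg_mul.
Qed.

Lemma poly_over_continuous n r (U : set M) (p : M * 'M[K]_(n, r) -> K) :
  ~~ is_algebraic g -> open U -> poly_over U p ->
  forall z, U z.1 -> {for z, continuous p}.
Proof.
move=> /(geometric_regular_continuous gM) cM oU + z Uz.
elim=> [_ [[f rf ->]|[j [k ->]]]|c|f h _ cf _ ch|f h _ cf _ ch].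
- apply: (cvg_comp fst f) (cM _ _ oU rf _ Uz).
  by case: z Uz => x T Ux; apply: cvg_fst.
- apply: (cvg_comp snd (fun T : 'M[K]_(n, r) => T j k))
    (@coord_continuous _ _ _ j k z.2).
  by case: z Uz => x T Ux; apply: cvg_snd.
- exact: cvg_cst.
- exact: cvgD.
- exact: cvgM.
Qed.

(** A supply of open sets common to all geometries: in the algebraic cases [U] and [p] are
    themselves the required data, in the manifold cases [p] is continuous over [U]. *)
Lemma open_in_prod_neq0 n r (U : set M) (p : M * 'M[K]_(n, r) -> K) :
  open U -> poly_over U p -> open_in_prod g [set z | U z.1 /\ p z != 0].
Proof.
move=> oU hp; rewrite /open_in_prod; case: ifPn => [_|nalg].
  by move=> w [Uw pw]; exists U, p.
rewrite openE => z [Uz pz]; apply: filterI.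
  case: z Uz pz => x T /= Ux _.
  apply: (cvg_fst (F := nbhs x) (G := nbhs T)).
  exact: open_nbhs_nbhs.
exact: cvgr_neq0 (poly_over_continuous nalg oU hp Uz) pz.
Qed.

(** This is a preimage under (x, T) -> (x, q(x, T)). In the algebraic cases polynomials are
    composed; in the manifold cases the map is continuous. *)
Lemma open_in_prod_subst n r n' r' (U : set M)
    (q : 'I_n' -> 'I_r' -> M * 'M[K]_(n, r) -> K)
    (W : set (M * 'M[K]_(n', r'))) :
  open U -> (forall j k, poly_over U (q j k)) -> open_in_prod g W ->
  open_in_prod g [set z | U z.1 /\ W (z.1, \matrix_(j, k) q j k z)].
Proof.
move=> oU hq; rewrite /open_in_prod; case: ifPn => [_ hW w [Uw /hW]|nalg oW].
  move=> [V [p [oV Vw pV pw pW]]].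
  have oUV : open (U `&` V) by exact: openI.
  exists (U `&` V), (fun z => p (z.1, \matrix_(j, k) q j k z)); split=> //.
  - apply: poly_over_comp => [j k|].
      by apply: poly_over_subset (hq j k) => // x [].
    by apply: poly_over_subset pV => // x [].
  - by move=> z [Uz Vz] pz; split=> //; apply: pW.
rewrite openE => z [Uz Wz].
have cq j k : {for z, continuous (q j k)}.
  exact: (poly_over_continuous nalg oU (hq j k) Uz).
apply: filterI.
  case: z Uz {Wz cq} => x T /= Ux.
  apply: (cvg_fst (F := nbhs x) (G := nbhs T)).
  exact: open_nbhs_nbhs.
have cfst : (fun y : M * 'M[K]_(n, r) => y.1) @ z --> z.1.
  by case: z {Uz Wz cq} => x T; exact: cvg_fst.
(* A neighbourhood of a matrix contains a product of neighbourhoods of its finitely many entries, so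
   entrywise continuity suffices. *)
have cmx : (fun y => \matrix_(j, k) q j k y) @ z --> \matrix_(j, k) q j k z.
  move=> B [P nP PB].
  have : \forall y \near z, forall j k, P j k (q j k y).
    have Fz := nbhs_filter z.
    apply: (filter_forall (F := nbhs z)) => j.
    apply: (filter_forall (F := nbhs z)) => k.
    by have := nP j k; rewrite mxE => /cq.
  by apply: filterS => y Py; apply: PB => j k; rewrite mxE.
have cpair : (fun y => (y.1, \matrix_(j, k) q j k y)) @ z -->
    (z.1, \matrix_(j, k) q j k z) by exact: cvg_pair cfst cmx.
exact: cpair (open_nbhs_nbhs (conj oW Wz)).
Qed.

(** Rank [r] means that some minor of size [r] is nonzero; [f] chooses its rows, and a choice with
    repetitions contributes the empty set. *)
Lemma open_in_prod_row_full n r :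
  open_in_prod g [set z : M * 'M[K]_(n, r) | row_full z.2].
Proof.
rewrite (_ : [set _ | _] = \bigcup_(f : 'I_r -> 'I_n)
    [set z : M * 'M[K]_(n, r) | setT z.1 /\ \det (rowsub f z.2) != 0]).
  apply: open_in_prod_bigU => f; apply: open_in_prod_neq0; first exact: openT.
  (* The Leibniz formula exhibits the minor as a polynomial in the entries. *)
  apply: poly_over_sum => s; apply: subalg_mul; first exact: subalg_cst.
  apply: poly_over_prod => i.
  rewrite (_ : (fun _ => _) = fun z : M * 'M[K]_(n, r) => z.2 (f i) (s i)).
    exact: poly_over_coord.
  by apply/funext => z; rewrite mxE.
apply/seteqP; split=> z /=.
  move=> zfull; exists (fullrankfun zfull) => //; split=> //.
  by have := fullrowsub_unit zfull; rewrite unitmxE unitfE.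
move=> [f _ [_]]; rewrite -unitfE -unitmxE -row_full_unit => /row_fullP[B BT].
apply/row_fullP; exists (B *m rowsub f 1%:M).
by rewrite -mulmxA -rowsubE.
Qed.

End PolynomialLoci.

(** * Linear algebra of preimages and kernels of given codimension *)

Section LinearAlgebra.
Variable K : fieldType.

Lemma exists_lfun_of_free (L L' : vectType K) n (e : 'I_n -> L) (u : 'I_n -> L') :
  free [seq e i | i <- enum 'I_n] -> exists h : 'Hom(L, L'), forall i, h (e i) = u i.
Proof.
move=> free_e.
have [f fE] := linear_of_free [seq e i | i <- enum 'I_n] [seq u i | i <- enum 'I_n].
exists (linfun f) => i; rewrite lfunE /=.
have := fE free_e; rewrite !size_map -map_comp => /(_ erefl)/eq_in_map; apply.
by rewrite mem_enum.
Qed.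

Lemma basis_row_coords (L : vectType K) n (e : 'I_n -> L) :
  basis_of {:L} [seq e i | i <- enum 'I_n] ->
  forall v, exists c : 'rV[K]_n, v = \sum_i c 0 i *: e i.
Proof.
rewrite -val_ord_tuple => /(coord_basis (X := [tuple e i | i < n])) be v.
rewrite (be v (memvf v)).
exists (\row_i coord [tuple e i | i < n] i v); apply: eq_bigr => i _.
by rewrite mxE -tnth_nth tnth_mktuple.
Qed.

(** Since [psi] is onto modulo [V], it induces an isomorphism from L'/psi^-1 V to L/V. The quotient
    by [V] is modelled by the endomorphism [q], whose kernel is [V], and rank-nullity is applied to
    [q] and to [q \o psi]. *)
Lemma dimv_lpreim_codim (L L' : vectType K) (psi : 'Hom(L', L)) (V : {vspace L}) r :
  (forall v, exists w, psi w - v \in V) ->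
  (\dim V + r = \dim {:L})%N -> (\dim (psi @^-1: V) + r = \dim {:L'})%N.
Proof.
move=> surj dimV.
pose q : 'End(L) := (projv V - \1)%VF.
have qE v : q v = projv V v - v by rewrite !lfun_simp.
have kerq : lker q = V.
  apply/vspaceP => v; rewrite memv_ker qE subr_eq0.
  by apply/eqP/idP => [<-|/projv_id//]; apply: memv_proj.
have kerqpsi : lker (q \o psi)%VF = (psi @^-1: V)%VS.
  by apply/vspaceP => w; rewrite -memv_preim memv_ker comp_lfunE -memv_ker kerq.
have imq : limg (q \o psi)%VF = limg q.
  rewrite limg_comp; apply/eqP; rewrite eqEsubv limgS ?subvf //=.
  apply/subvP => _ /memv_imgP[v _ ->]; have [w wv] := surj v.
  have -> : q v = q (psi w).
    by apply/eqP; rewrite eq_sym -subr_eq0 -linearB /= -memv_ker kerq.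
  by do 2!apply: memv_img; apply: memvf.
have := limg_ker_dim q fullv; rewrite capfv kerq -dimV => /addnI dimq.
by have := limg_ker_dim (q \o psi)%VF fullv; rewrite capfv kerqpsi imq dimq.
Qed.

End LinearAlgebra.

(** [T] is the matrix of a linear map [h] from [L] to K^r with kernel [V]; by rank-nullity [V] has
    codimension [r] exactly when [h] is onto. *)
Lemma kernel_coords_codim (K : numFieldType) (L : vectType K) n r (e : 'I_n -> L)
    (T : 'M[K]_(n, r)) (V : {vspace L}) :
  basis_of {:L} [seq e i | i <- enum 'I_n] -> kernel_coords e T V ->
  (\dim V + r = \dim {:L})%N <-> row_full T.
Proof.
move=> be kV.
have [h hE] := exists_lfun_of_free (fun i => row i T) (basis_free be).
have hsum (c : 'rV[K]_n) : h (\sum_i c 0 i *: e i) = c *m T.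
  rewrite linear_sum mulmx_sum_row; apply: eq_bigr => i _.
  by rewrite linearZ /= hE.
have kerh : lker h = V.
  apply/vspaceP => v; have [c ->] := basis_row_coords be v.
  by rewrite memv_ker hsum kV.
have full_r : \dim {: 'rV[K]_r} = r by rewrite dimvf /dim /= mul1n.
have := limg_ker_dim h fullv; rewrite capfv kerh => dimV.
split=> [dimVr|Tfull].
  have imh : limg h = fullv.
    apply/eqP; rewrite eqEdim subvf full_r /=.
    by move: dimV; rewrite -dimVr => /addnI ->.
  have /choice[c hc] (j : 'I_r) : exists c : 'rV[K]_n, c *m T = delta_mx 0 j.
    have := memvf (delta_mx 0 j : 'rV[K]_r); rewrite -imh.
    move=> /memv_imgP[v _ ->]; have [c ->] := basis_row_coords be v.
    by exists c; rewrite hsum.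
  apply/row_fullP; exists (\matrix_j c j); apply/row_matrixP => j.
  by rewrite row_mul rowK hc row1.
have [B BT] := row_fullP Tfull.
have imh : limg h = fullv.
  apply/eqP; rewrite eqEsubv subvf /=; apply/subvP => w _.
  have -> : w = h (\sum_i (w *m B) 0 i *: e i).
    by rewrite hsum -mulmxA BT mulmx1.
  by apply: memv_img; apply: memvf.
by rewrite -dimV imh full_r.
Qed.

(** * Sections, comparison morphisms and independence of the regular locus *)

Section Bundles.
Variables (K : numFieldType) (M : kspace K).

Lemma frame_sect (B : vbundle M) (U V : set M) n (e : 'I_n -> forall x, B x) i :
  is_frame U e -> open V -> V `<=` U -> sect V (e i).
Proof.
move=> [oU be eP] oV VU; apply/(eP _ _ oV VU).
exists (fun j => fun=> (j == i)%:R); split=> [j|y Vy].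
  exact: regular_cst.
rewrite (bigD1 i) //= eqxx scale1r big1 ?addr0 // => j /negPf ->.
by rewrite scale0r.
Qed.

(** Module operations on sections are derived from local triviality: over a frame, sections are the
    combinations with regular coefficients, and these glue. *)
Lemma sect_lincomb (B : vbundle M) (U : set M) (I : Type) (l : seq I)
    (a : I -> forall x, B x) (f : I -> M -> K) (s : forall x, B x) :
  open U -> (forall i, sect U (a i)) -> (forall i, regular U (f i)) ->
  (forall x, U x -> s x = \sum_(i <- l) f i x *: a i x) -> sect U s.
Proof.
move=> oU sa rf sE; apply: sect_glue => // x Ux.
have [U0 [n [e [U0x [oU0 _ eP]]]]] := sect_trivial B x.
have oV : open (U `&` U0) by exact: openI.
have VU0 : U `&` U0 `<=` U0 by apply: subIsetr.
exists (U `&` U0); split=> //.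
have /choice[h hP] i : exists h : 'I_n -> M -> K,
    (forall j, regular (U `&` U0) (h j)) /\
    forall y, (U `&` U0) y -> a i y = \sum_j h j y *: e j y.
  apply/(eP _ _ oV VU0).
  by apply: sect_sub (sa i) => // y [].
apply/(eP _ _ oV VU0).
exists (fun j y => \sum_(i <- l) f i y * h i j y); split=> [j|y Vy].
  apply: regular_sum => // i; apply: regular_mul => //; last by have [] := hP i.
  by apply: regular_sub (rf i) => // y [].
rewrite sE; last by case: Vy.
under eq_bigr => i _ do rewrite (hP i).2 // scaler_sumr.
rewrite exchange_big /=; apply: eq_bigr => j _.
by rewrite scaler_suml; apply: eq_bigr => i _; rewrite scalerA.
Qed.

Variables (E : lie_algebroid M) (F : singular_subalgebroid E).

(** The image under rho of each frame section of [A] lies in [F], hence lifts through rho' to a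
    section of [A'] near [x]; [phi] sends the frame to these lifts. *)
Lemma exists_comparison (A A' : almost_lie_algebroid F) (x : M) :
  exists U (phi : forall y, 'Hom(A y, A' y)), U x /\ is_comparison U phi.
Proof.
have [U [n [e [Ux eF]]]] := sect_trivial A x.
have [oU be eP] := eF.
have /choice[V HV] i : exists V : set M, exists a : forall y, A' y,
    [/\ open V, V x, sect V a &
      forall y, V y -> al_rho A y (e i y) = al_rho A' y (a y)].
  have /(al_image A' _ oU)/(_ x Ux) : F U (fun y => al_rho A y (e i y)).
    apply/(al_image A _ oU) => y Uy; exists U, (e i); split=> //.
    exact: frame_sect eF _ _.
  by move=> [V [a [oV Vx VU sa aE]]]; exists V, a.
pose a i := projT1 (cid (HV i)).
have aP i : [/\ open (V i), V i x, sect (V i) (a i) &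
    forall y, V i y -> al_rho A y (e i y) = al_rho A' y (a i y)].
  exact: projT2 (cid (HV i)).
have phiP y : exists h : 'Hom(A y, A' y), U y -> forall i, h (e i y) = a i y.
  (* Off [U] the family [e] need not be a basis; 0 is a default value there. *)
  have [Uy|nUy] := pselect (U y); last by exists 0.
  by have [h hE] := exists_lfun_of_free (a^~ y) (basis_free (be y Uy)); exists h.
pose phi y := projT1 (cid (phiP y)).
have phiE y i : U y -> phi y (e i y) = a i y.
  by move=> Uy; exact: projT2 (cid (phiP y)) Uy i.
(* The interior makes [W] open at once; [W] contains [x] because the [V i] are finitely many. *)
pose W : set M := U `&` interior [set y | forall i, V i y].
have oW : open W by apply: openI => //; exact: open_interior.
have WU : W `<=` U by apply: subIsetl.
have WV i : W `<=` V i by move=> y [_ /interior_subset]; apply.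
exists W, phi; split; first split=> //.
  have Fx := nbhs_filter x.
  apply: (filter_forall (F := nbhs x)) => i.
  by have [oV Vx _ _] := aP i; apply: open_nbhs_nbhs.
split=> //.
- move=> W' s oW' W'W sW'.
  have W'U : W' `<=` U by apply: subset_trans W'W WU.
  have [f [rf sE]] := (eP _ _ oW' W'U).1 sW'.
  apply: (sect_lincomb (l := index_enum 'I_n) (a := a) (f := f)) => //.
    move=> i; have [oV _ sa _] := aP i.
    by apply: sect_sub sa => //; apply: subset_trans W'W (WV i).
  move=> y W'y; rewrite sE // linear_sum; apply: eq_bigr => i _.
  by rewrite linearZ /= phiE //; exact: W'U.
- move=> y Wy; apply/lfunP => v; have [c ->] := basis_row_coords (be y (WU y Wy)) v.
  rewrite comp_lfunE !linear_sum; apply: eq_bigr => i _.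
  rewrite !linearZ /= phiE; last exact: WU.
  by have [_ _ _ ->] := aP i => //; exact: WV.
Qed.

Lemma comparison_subset (A A' : almost_lie_algebroid F) (U V : set M)
    (phi : forall y, 'Hom(A y, A' y)) :
  open V -> V `<=` U -> is_comparison U phi -> is_comparison V phi.
Proof.
move=> oV VU [oU hphi rphi]; split=> // [W s oW WV|x /VU].
  by apply: hphi => //; apply: subset_trans WV VU.
exact: rphi.
Qed.

Lemma comparison_comp (A A' A'' : almost_lie_algebroid F) (U : set M)
    (phi : forall y, 'Hom(A y, A' y)) (psi : forall y, 'Hom(A' y, A'' y)) :
  is_comparison U phi -> is_comparison U psi ->
  is_comparison U (fun y => (psi y \o phi y)%VF).
Proof.
move=> [oU hphi rphi] [_ hpsi rpsi]; split=> // [W s oW WU sW|x Ux].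
  have := hpsi _ _ oW WU (hphi _ _ oW WU sW).
  by congr sect; apply: functional_extensionality_dep => x; rewrite comp_lfunE.
by rewrite comp_lfunA rpsi // rphi.
Qed.

(** [psi] comes from a separate lifting and is in general no inverse of [phi]; both are restricted
    to a common open set. *)
Lemma exists_reverse_comparison (A A' : almost_lie_algebroid F) (U : set M)
    (phi : forall y, 'Hom(A y, A' y)) x :
  is_comparison U phi -> U x ->
  exists V (psi : forall y, 'Hom(A' y, A y)),
    [/\ V x, is_comparison V phi & is_comparison V psi].
Proof.
move=> cphi Ux; have [V [psi [Vx cpsi]]] := exists_comparison A' A x.
have [oU _ _] := cphi; have [oV _ _] := cpsi.
have oI : open (U `&` V) by exact: openI.
exists (U `&` V), psi; split=> //.
  by apply: comparison_subset cphi => // y [].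
by apply: comparison_subset cpsi => // y [].
Qed.

Lemma exists_comparison_pair (A A' : almost_lie_algebroid F) (x : M) :
  exists U (phi : forall y, 'Hom(A y, A' y)) (psi : forall y, 'Hom(A' y, A y)),
    [/\ U x, is_comparison U phi & is_comparison U psi].
Proof.
have [U [phi [Ux cphi]]] := exists_comparison A A' x.
by have [V [psi ?]] := exists_reverse_comparison cphi Ux; exists V, phi, psi.
Qed.

(** Factoring rho through rho' gives an inclusion of images at [x], and the argument is
    symmetric. *)
Lemma rho_rank_indep (A A' : almost_lie_algebroid F) x :
  rho_rank A x = rho_rank A' x.
Proof.
have le (B B' : almost_lie_algebroid F) : (rho_rank B x <= rho_rank B' x)%N.
  have [U [phi [Ux [_ _ rphi]]]] := exists_comparison B B' x.
  by rewrite /rho_rank -rphi // limg_comp dimvS // limgS // subvf.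
by apply/eqP; rewrite eqn_leq !le.
Qed.

Lemma Mreg_indep (A A' : almost_lie_algebroid F) : Mreg A = Mreg A'.
Proof.
by apply/seteqP; split=> x; apply: filterS => y; rewrite !(rho_rank_indep A A').
Qed.

End Bundles.

(** * Points of two Grassmann bundles related by taking preimages *)

Section Corresponds.
Variables (K : numFieldType) (M : kspace K) (r : nat) (A A' : vbundle M).
Variable phi : forall x, 'Hom(A x, A' x).

Lemma corresponds_gpt (p : grass A r) (p' : grass A' r) :
  corresponds phi p p' -> gpt p' = gpt p.
Proof. by case. Qed.

(** This inversion and the next put both subspaces over one base point, which avoids transport along
    [gpt p' = gpt p]. *)
Lemma corresponds_inv (p : grass A r) (p' : grass A' r) : corresponds phi p p' ->
  exists V' hV', p' = @Grass _ _ A' r (gpt p) V' hV' /\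
    gsub p = (phi (gpt p) @^-1: V')%VS.
Proof. by case=> x V V' hV hV' VE; exists V', hV'. Qed.

Lemma corresponds_invr (p : grass A r) (p' : grass A' r) : corresponds phi p p' ->
  exists hV, p = @Grass _ _ A r (gpt p') (phi (gpt p') @^-1: gsub p')%VS hV.
Proof. by case=> x V V' hV hV' VE; case: _ / (esym VE) in hV *; exists hV. Qed.

Lemma corresponds_lpreim (p' : grass A' r)
    (hV : (\dim (phi (gpt p') @^-1: gsub p') + r = \dim {: A (gpt p')})%N) :
  corresponds phi (Grass hV) p'.
Proof. by case: p' hV => x V' hV' hV; apply: Corresponds. Qed.

End Corresponds.

Lemma corresponds_comp (K : numFieldType) (M : kspace K) r (A A' A'' : vbundle M)
    (phi : forall x, 'Hom(A x, A' x)) (psi : forall x, 'Hom(A' x, A'' x))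
    (p : grass A r) (p' : grass A' r) (p'' : grass A'' r) :
  corresponds phi p p' -> corresponds psi p' p'' ->
  corresponds (fun x => (psi x \o phi x)%VF) p p''.
Proof.
case=> x V V' hV hV' VE /corresponds_inv[V'' [hV'' [-> /= V'E]]].
apply: Corresponds; apply/vspaceP => v.
by rewrite VE -!memv_preim comp_lfunE V'E -memv_preim.
Qed.

(** * Comparison morphisms acting on Nash blow-ups *)

Section NashBlowup.
Variables (R : realType) (K : numFieldType) (g : geometry R K) (M : kspace K).
Hypothesis gM : is_geometric g M.

Lemma open_grassE (A : vbundle M) r (O : set (grass_space g A r)) :
  open O = grass_open O.
Proof. by []. Qed.

(** In a frame, with V = ker T, the section lies in V exactly when its coordinate row times T
    vanishes; so the locus is a union of loci where a polynomial is nonzero. *)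
Lemma grass_open_notin (A : vbundle M) r (U : set M) (s : forall x, A x) :
  open U -> sect U s ->
  open [set q : grass_space g A r | U (gpt q) /\ s (gpt q) \notin gsub q].
Proof.
move=> oU sU; rewrite open_grassE => U2 n e eF; have [oU2 _ eP] := eF.
have oI : open (U `&` U2) by exact: openI.
have IU2 : U `&` U2 `<=` U2 by apply: subIsetr.
have [f [rf sE]] : exists f : 'I_n -> M -> K, (forall i, regular (U `&` U2) (f i)) /\
    forall y, (U `&` U2) y -> s y = \sum_i f i y *: e i y.
  by apply/(eP _ _ oI IU2); apply: sect_sub sU => // y [].
exists (\bigcup_j [set z : M * 'M[K]_(n, r) |
    (U `&` U2) z.1 /\ \sum_i f i z.1 * z.2 i j != 0]).
  apply: open_in_prod_bigU => j; apply: open_in_prod_neq0 => //.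
  apply: poly_over_sum => i; apply: subalg_mul; first exact: poly_over_regular.
  exact: poly_over_coord.
move=> q T U2q kT.
have memE : U (gpt q) ->
    (s (gpt q) \in gsub q) = ((\row_i f i (gpt q)) *m T == 0).
  by move=> Uq; rewrite -kT sE //; under [in RHS]eq_bigr do rewrite mxE.
split=> [[Uq]|[j _ /= [[Uq _] nz]]].
  rewrite memE // => /matrix0Pn[i [j]]; rewrite mxE.
  by under eq_bigr do rewrite mxE; exists j.
split=> //; rewrite memE //; apply/matrix0Pn; exists 0, j; rewrite mxE.
by under eq_bigr do rewrite mxE.
Qed.

Variables (E : lie_algebroid M) (F : singular_subalgebroid E) (r : nat).
Implicit Types A : almost_lie_algebroid F.

(** Otherwise the open set of subspaces avoiding [s] would be a neighbourhood of [p], yet it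
    contains no kernel of rho over [U]. *)
Lemma nash_sect_mem A (p : grass_space g A r) (U : set M) (s : forall x, A x) :
  open U -> sect U s -> (forall y, U y -> al_rho A y (s y) = 0) ->
  nash_blowup g r A p -> U (gpt p) -> s (gpt p) \in gsub p.
Proof.
move=> oU sU rho0 clp Up; apply/negPn/negP => nsp.
have oO := grass_open_notin r oU sU.
have [q [[_ qE] [Uq]]] := clp _ (open_nbhs_nbhs (conj oO (conj Up nsp))).
by rewrite qE memv_ker rho0 // eqxx.
Qed.

(** For each frame section e_i, the section psi(e_i) - e_i is killed by the anchor, so its value
    lies in the subspace; linearity does the rest. *)
Lemma nash_comparison_endo A (p : grass_space g A r) (U : set M)
    (psi : forall x, 'Hom(A x, A x)) :
  is_comparison U psi -> nash_blowup g r A p -> U (gpt p) ->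
  forall v, psi (gpt p) v - v \in gsub p.
Proof.
move=> [oU hpsi rpsi] clp Up v.
have [U0 [n [e [U0p eF]]]] := sect_trivial A (gpt p).
have [oU0 be _] := eF.
have oI : open (U `&` U0) by exact: openI.
have mem_e i : psi (gpt p) (e i (gpt p)) - e i (gpt p) \in gsub p.
  have se : sect (U `&` U0) (e i) by apply: frame_sect eF _ _ => // y [].
  apply: (nash_sect_mem (U := U `&` U0) (s := fun y => psi y (e i y) - e i y)) => //.
  (* The difference is a combination of two sections indexed by booleans, with coefficients 1 and
     -1. *)
  - apply: (sect_lincomb (l := [:: true; false])
      (a := fun b y => if b then psi y (e i y) else e i y)
      (f := fun b _ => if b then 1 else -1)) => //.
    + by case=> //; apply: hpsi => // y [].
    + by case; exact: regular_cst.
    + by move=> y _; rewrite !big_cons big_nil addr0 scale1r scaleN1r.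
  - move=> y [Uy _]; rewrite linearB /= -comp_lfunE rpsi //.
    by rewrite subrr.
have [c ->] := basis_row_coords (be _ U0p) v.
rewrite linear_sum -sumrB; apply: rpred_sum => i _.
by rewrite linearZ /= -scalerBr; apply: memvZ.
Qed.

Lemma nash_lpreim_endo A (p : grass_space g A r) (U : set M)
    (psi : forall x, 'Hom(A x, A x)) :
  is_comparison U psi -> nash_blowup g r A p -> U (gpt p) ->
  (psi (gpt p) @^-1: gsub p)%VS = gsub p.
Proof.
move=> cpsi clp Up; apply/vspaceP => v; rewrite -memv_preim.
by rewrite -(rpredDl v (nash_comparison_endo cpsi clp Up v)) subrK.
Qed.

(** A neighbourhood of [p'] is pulled back along V -> psi^-1 V to a neighbourhood of [p]. The latter
    contains some ker rho_y with y regular, whose preimage is ker rho'_y. *)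
Lemma nash_lpreim A A' (U : set M) (psi : forall x, 'Hom(A' x, A x))
    (p : grass_space g A r) (p' : grass_space g A' r) :
  is_comparison U psi -> U (gpt p) -> corresponds psi p' p ->
  nash_blowup g r A p -> nash_blowup g r A' p'.
Proof.
move=> [oU hpsi rpsi] Up pp' clp B; rewrite nbhsE => -[N [oN Np'] NB].
have [U' [n' [e' [U'p eF']]]] := sect_trivial A' (gpt p).
have [oU' be' _] := eF'.
(* The existence of [q'] encodes that the preimage has codimension [r], the domain on which the map
   is defined. *)
pose O := [set q : grass_space g A r |
  (U `&` U') (gpt q) /\
  exists2 q' : grass_space g A' r, corresponds psi q' q & N q'].
have oO : open O.
  rewrite open_grassE => U2 n e eF; have [oU2 be eP] := eF.
  pose U3 := U `&` U' `&` U2.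
  have oU3 : open U3 by do 2!apply: openI => //.
  have U3U2 : U3 `<=` U2 by apply: subIsetr.
  (* [P] is the matrix of [psi] in the frames [e'] and [e], with rows indexed by [e']. *)
  have /choice[P PE] j : exists f : 'I_n -> M -> K, (forall i, regular U3 (f i)) /\
      forall y, U3 y -> psi y (e' j y) = \sum_i f i y *: e i y.
    apply/(eP _ _ oU3 U3U2); apply: hpsi => //; first by move=> y [[]].
    by apply: frame_sect eF' _ _ => // y [[]].
  have [W' oW' W'E] := oN _ _ _ eF'.
  pose q j k (z : M * 'M[K]_(n, r)) := \sum_i P j i z.1 * z.2 i k.
  (* [q] gives the entries of P T. Full rank of P T is the codimension condition, and [W'] describes
     [N] in the frame [e']. *)
  exists [set z | U3 z.1 /\
    ([set z' | row_full z'.2] `&` W') (z.1, \matrix_(j, k) q j k z)].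
    apply: open_in_prod_subst => //; last first.
      by apply: open_in_prodI => //; apply: open_in_prod_row_full.
    move=> j k; apply: poly_over_sum => i; apply: subalg_mul.
      by apply: poly_over_regular; have [] := PE j.
    exact: poly_over_coord.
  move=> [y V hV] T /= U2y kT; rewrite /O /=.
  set PT := \matrix_(j, k) _.
  have kPT : (U `&` U') y -> kernel_coords (e'^~ y) PT (psi y @^-1: V)%VS.
    move=> Uy c; rewrite -memv_preim linear_sum.
    have -> : PT = (\matrix_(j, i) P j i y) *m T.
      by apply/matrixP => j k; rewrite !mxE; apply: eq_bigr => i _; rewrite mxE.
    rewrite mulmxA -kT; congr (_ \in V).
    under eq_bigr => j _ do rewrite linearZ /= (PE j).2 // scaler_sumr.
    rewrite exchange_big /=; apply: eq_bigr => i _; rewrite mxE scaler_suml.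
    by apply: eq_bigr => j _; rewrite scalerA mxE.
  split=> [[Uy [q' /corresponds_invr[/= hV' ->] Nq']]|[[Uy _] [PTfull W'PT]]].
    split; first by split.
    split; first exact/(kernel_coords_codim (be' _ Uy.2) (kPT Uy)).
    exact/(W'E (Grass hV') _ Uy.2 (kPT Uy)).
  have hV' := (kernel_coords_codim (be' _ Uy.2) (kPT Uy)).2 PTfull.
  split=> //; exists (Grass hV'); first exact: (corresponds_lpreim (p' := Grass hV)).
  exact/(W'E (Grass hV') _ Uy.2 (kPT Uy)).
have Op : O p by split=> //; exists p'.
have [q [[regq qE] [Uq [q' qq' Nq']]]] := clp _ (open_nbhs_nbhs (conj oO Op)).
exists q'; split; last exact: NB.
move: qE regq Uq; rewrite /= -!(Mreg_indep A A').
case: qq' => y V' V hV' hV /= -> -> regy [Uy _]; split=> //.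
by apply/vspaceP => v; rewrite -memv_preim !memv_ker -comp_lfunE rpsi.
Qed.

(** The point is (x, psi^-1 V) for one fixed [psi]. For any comparison chi, psi o chi is an
    endomorphism of [A] over the anchor, so chi^-1 (psi^-1 V) = V: this is what removes the
    dependence on choices. *)
Lemma nash_corresponds_ex A A' (p : grass_space g A r) :
  nash_blowup g r A p -> exists2 p' : grass_space g A' r, nash_blowup g r A' p' &
    forall U (phi : forall x, 'Hom(A x, A' x)),
      is_comparison U phi -> U (gpt p) -> corresponds phi p p'.
Proof.
move=> clp.
have [U [phi [psi [Up cphi cpsi]]]] := exists_comparison_pair A A' (gpt p).
have hV' : (\dim (psi (gpt p) @^-1: gsub p) + r = \dim {: A' (gpt p)})%N.
  (* Surjectivity of [psi] modulo V is witnessed by [phi], as psi (phi v) - v lies in V. *)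
  apply: dimv_lpreim_codim (gcodim p) => v; exists (phi (gpt p) v).
  rewrite -comp_lfunE.
  exact: (nash_comparison_endo (comparison_comp cphi cpsi) clp Up).
have pp' := corresponds_lpreim hV'.
exists (Grass hV'); first exact: nash_lpreim cpsi Up pp' clp.
move=> V chi cchi Vp.
have [oU _ _] := cphi; have [oV _ _] := cchi.
have oI : open (V `&` U) by exact: openI.
have cI : is_comparison (V `&` U) (fun x => (psi x \o chi x)%VF).
  apply: comparison_comp.
    by apply: comparison_subset cchi => // y [].
  by apply: comparison_subset cpsi => // y [].
have := nash_lpreim_endo cI clp (conj Vp Up).
move: hV' {pp'}; case: p {clp Up Vp} => x S hS /= hV' SE.
apply: Corresponds; rewrite -[LHS]SE; apply/vspaceP => v.
by rewrite -!memv_preim comp_lfunE.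
Qed.

Lemma corresponds_self A (p : grass_space g A r) (U : set M)
    (psi : forall x, 'Hom(A x, A x)) :
  is_comparison U psi -> nash_blowup g r A p -> U (gpt p) -> corresponds psi p p.
Proof.
move=> cpsi clp Up; have := nash_lpreim_endo cpsi clp Up.
by case: p {clp Up} => x S hS /= SE; apply: Corresponds.
Qed.

(** phi o psi is the identity modulo V', so V' can be recovered from its preimage under [phi]. *)
Lemma corresponds_lpreimE A A' (U : set M) (phi : forall x, 'Hom(A x, A' x))
    (psi : forall x, 'Hom(A' x, A x)) x
    (V' : {vspace A' x}) hV' :
  is_comparison U phi -> is_comparison U psi -> U x ->
  nash_blowup g r A' (@Grass _ _ A' r x V' hV') ->
  V' = (psi x @^-1: (phi x @^-1: V'))%VS.
Proof.
move=> cphi cpsi Ux cl.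
rewrite -[LHS](nash_lpreim_endo (comparison_comp cpsi cphi) cl Ux).
by apply/vspaceP => v; rewrite -!memv_preim comp_lfunE.
Qed.

Lemma corresponds_inj A A' (U : set M) (phi : forall x, 'Hom(A x, A' x))
    (p : grass_space g A r) (p1 p2 : grass_space g A' r) :
  is_comparison U phi -> U (gpt p) ->
  nash_blowup g r A' p1 -> nash_blowup g r A' p2 ->
  corresponds phi p p1 -> corresponds phi p p2 -> p1 = p2.
Proof.
move=> cphi Up cl1 cl2 pp1 /corresponds_inv[V2 [hV2 [p2E /= VE]]].
have [{cphi}W [psi [{}Up cphi cpsi]]] := exists_reverse_comparison cphi Up.
move: p2E VE Up cl1 cl2 => ->; case: pp1 V2 hV2 => x V V1 hV hV1 VE1 V2 hV2 /= VE Ux.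
move=> /(corresponds_lpreimE cphi cpsi Ux) V1E.
move=> /(corresponds_lpreimE cphi cpsi Ux) V2E.
have V12 : V1 = V2 by rewrite V1E -VE1 VE -V2E.
(* Once the subspaces agree, the codimension proofs agree, being equalities in [nat]. *)
by case: _ / V12 in hV2 *; rewrite (eq_irrelevance hV1 hV2).
Qed.

(** Here V' = psi^-1 V, and the preimage of ker rho under [psi] is ker rho' because rho o psi =
    rho'. *)
Lemma nash_lker A A' (p : grass_space g A r) (p' : grass_space g A' r)
    (U : set M) (phi : forall x, 'Hom(A x, A' x)) :
  is_comparison U phi -> U (gpt p) -> corresponds phi p p' ->
  nash_blowup g r A' p' ->
  gsub p = lker (al_rho A (gpt p)) -> gsub p' = lker (al_rho A' (gpt p')).
Proof.
move=> cphi Up pp' cl'.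
have [{cphi}W [psi [{}Up cphi cpsi]]] := exists_reverse_comparison cphi Up.
have [_ _ rpsi] := cpsi.
case: pp' Up cl' => x V V' hV hV' VE /= Ux cl' Vker.
rewrite (corresponds_lpreimE cphi cpsi Ux cl') -VE Vker.
by apply/vspaceP => v; rewrite -memv_preim !memv_ker -comp_lfunE rpsi.
Qed.

End NashBlowup.

Theorem proposition2p14 (R : realType) (K : numFieldType) (g : geometry R K)
    (M : kspace K) (hM : is_geometric g M)
    (E : lie_algebroid M) (F : singular_subalgebroid E)
    (A A' : almost_lie_algebroid F) (r : nat)
    (hr : forall x, Mreg A x -> rho_rank A x = r)
    (hr' : forall x, Mreg A' x -> rho_rank A' x = r) :
  exists! Phi : nash_blowup g r A -> nash_blowup g r A',
    [/\ bijective Phi,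
        forall p, gpt (val (Phi p)) = gpt (val p) &
        is_canonical Phi].
Proof.
(* Stated for any ordered pair, so that it yields both the map and its inverse. *)
have exPhi (B B' : almost_lie_algebroid F) :
    exists Phi : nash_blowup g r B -> nash_blowup g r B', forall p U phi,
      is_comparison U phi -> U (gpt (val p)) -> corresponds phi (val p) (val (Phi p)).
  have /choice[f fP] (p : nash_blowup g r B) : exists p' : nash_blowup g r B',
      forall U phi, is_comparison U phi -> U (gpt (val p)) ->
      corresponds phi (val p) (val p').
    have [p' clp' pp'] := nash_corresponds_ex hM B' (set_valP p).
    by exists (exist _ p' (mem_set clp')).
  by exists f.
have [Phi PhiP] := exPhi A A'; have [Psi PsiP] := exPhi A' A.
(* Along psi o phi, [p] corresponds both to [h (f p)] and to itself; injectivity of the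
   correspondence identifies the two. *)
have can (B B' : almost_lie_algebroid F)
    (f : nash_blowup g r B -> nash_blowup g r B')
    (h : nash_blowup g r B' -> nash_blowup g r B) :
  (forall p U phi, is_comparison U phi -> U (gpt (val p)) ->
    corresponds phi (val p) (val (f p))) ->
  (forall p U phi, is_comparison U phi -> U (gpt (val p)) ->
    corresponds phi (val p) (val (h p))) -> cancel f h.
  move=> fP hP p; apply: val_inj.
  have [U [phi [psi [Up cphi cpsi]]]] := exists_comparison_pair B B' (gpt (val p)).
  have pf := fP p _ _ cphi Up.
  have Ufp : U (gpt (val (f p))) by rewrite (corresponds_gpt pf).
  have cc := comparison_comp cphi cpsi.
  apply: (corresponds_inj hM cc Up (set_valP _) (set_valP p)).
    exact: corresponds_comp pf (hP _ _ _ cpsi Ufp).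
  exact: (corresponds_self hM cc (set_valP p) Up).
exists Phi; split.
  split.
  - by exists Psi; [exact: can PhiP PsiP|exact: can PsiP PhiP].
  - move=> p; have [U [phi [Up cphi]]] := exists_comparison A A' (gpt (val p)).
    exact: corresponds_gpt (PhiP p _ _ cphi Up).
  - split=> [p _ pker|U phi cphi p Up]; last exact: PhiP cphi Up.
    have [U [phi [Up cphi]]] := exists_comparison A A' (gpt (val p)).
    exact: (nash_lker hM cphi Up (PhiP p _ _ cphi Up) (set_valP (Phi p)) pker).
(* Uniqueness: near the base point of [p] some comparison exists, and along it both [Phi p] and
   [Phi' p] correspond to [p]. *)
move=> Phi' [_ _ [_ Phi'P]]; apply/funext => p; apply: val_inj.
have [U [phi [Up cphi]]] := exists_comparison A A' (gpt (val p)).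
exact: (corresponds_inj hM cphi Up (set_valP _) (set_valP _) (PhiP p _ _ cphi Up)
  (Phi'P U phi cphi p Up)).
Qed.
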